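(* Suppose $\mathcal{Y}=\mathbb{R}^n$ and each $f_i$ is differentiable with $\nabla f_i$ Lipschitz continuous on $\mathbb{R}^n$ with constant $L_i>0$, $i=1,\dots,m$, and let $L=\max_iL_i$. Then the function $-g$ is strongly convex with constant $(1/L)\left[2-2\cos(\pi/m)\right]$.
   Context: Let $m\ge2$, $n\ge1$ be integers, $\mathcal{Y}\subseteq\mathbb{R}^n$ a closed convex set, and $f_i:\mathbb{R}^n\to\mathbb{R}$, $i=1,\dots,m$, strictly convex closed functions. For $\mathbf{y}=(\mathbf{y}_1,\dots,\mathbf{y}_m)\in(\mathbb{R}^n)^m=\mathbb{R}^{nm}$ put $f(\mathbf{y})=\sum_{i=1}^m f_i(\mathbf{y}_i)$, and $\mathbf{A}\mathbf{y}=(\mathbf{y}_1-\mathbf{y}_2,\dots,\mathbf{y}_{m-1}-\mathbf{y}_m)\in\mathbb{R}^{n(m-1)}$. The dual function, with values in the extended reals, is $g(\boldsymbol{\lambda})=\inf_{\mathbf{y}\in\mathcal{Y}^m}\big[f(\mathbf{y})+\boldsymbol{\lambda}^{T}\mathbf{A}\mathbf{y}\big]$, $\boldsymbol{\lambda}\in\mathbb{R}^{n(m-1)}$. Norms are Euclidean. A function $\varphi$ with values in $\mathbb{R}\cup\{+\infty\}$ is strongly convex with constant $\sigma>0$ if $\varphi((1-\theta)\mathbf{x}+\theta\mathbf{x}')\le(1-\theta)\varphi(\mathbf{x})+\theta\varphi(\mathbf{x}')-\frac{\sigma}{2}\theta(1-\theta)\|\mathbf{x}-\mathbf{x}'\|^2$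 for all $\mathbf{x},\mathbf{x}'$ and $\theta\in(0,1)$. *)

(* Defs.v *)
From mathcomp Require Import all_boot all_order all_algebra.
From mathcomp Require Import all_classical all_reals all_analysis.

Set Implicit Arguments.
Unset Strict Implicit.
Unset Printing Implicit Defensive.

Import Order.TTheory GRing.Theory Num.Theory.
Import numFieldNormedType.Exports.

Local Open Scope classical_set_scope.
Local Open Scope ring_scope.

(* A point (y_1, ..., y_p) of (R^n)^p = R^(np) is the p x n matrix whose i-th
   row is y_i; a vector of R^n is the case p = 1. *)

Definition dot (R : realType) (p q : nat) (x y : 'M[R]_(p, q)) : R :=
  \sum_(i < p) \sum_(j < q) x i j * y i j.

(* The norm `|x| of the library on matrices is the sup norm; this one is
   Euclidean. *)
Definition enorm (R : realType) (p q : nat) (x : 'M[R]_(p, q)) : R :=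
  Num.sqrt (dot x x).

Definition strictly_convex (R : realType) (n : nat) (f : 'rV[R]_n -> R) : Prop :=
  forall (x x' : 'rV[R]_n) (t : R), x != x' -> 0 < t -> t < 1 ->
    f ((1 - t) *: x + t *: x') < (1 - t) * f x + t * f x'.

(* Closedness in the sense of convex analysis: the epigraph is closed. *)
Definition closed_function (R : realType) (n : nat) (f : 'rV[R]_n -> R) : Prop :=
  closed [set z : 'rV[R]_n * R | f z.1 <= z.2].

Definition grad (R : realType) (n : nat) (f : 'rV[R]_n -> R) (x : 'rV[R]_n) :
    'rV[R]_n :=
  \row_(j < n) 'D_(delta_mx 0 j) f x.

Definition elipschitz (R : realType) (n : nat) (K : R)
    (F : 'rV[R]_n -> 'rV[R]_n) : Prop :=
  forall x x' : 'rV[R]_n, enorm (F x - F x') <= K * enorm (x - x').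

Definition ord_fst (m : nat) (i : 'I_m.-1) : 'I_m := widen_ord (leq_pred m) i.

Definition ord_snd (m : nat) (i : 'I_m.-1) : 'I_m :=
  Ordinal (etrans (esym (ltn_predRL i m)) (ltn_ord i)).

Definition Adiff (R : realType) (m n : nat) (y : 'M[R]_(m, n)) :
    'M[R]_(m.-1, n) :=
  \matrix_(i < m.-1, j < n) (y (ord_fst i) j - y (ord_snd i) j).

Definition dual (R : realType) (m n : nat) (Y : set 'rV[R]_n)
    (f : 'I_m -> 'rV[R]_n -> R) (lambda : 'M[R]_(m.-1, n)) : \bar R :=
  ereal_inf [set (\sum_(i < m) f i (row i y) + dot lambda (Adiff y))%:E
            | y in [set y : 'M[R]_(m, n) | forall i, Y (row i y)]].

(* The conjunct -oo < phi x says that phi takes its values in R u {+oo}, so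
   that the right-hand side below never involves +oo - oo. *)
Definition strongly_convex (R : realType) (p q : nat) (sigma : R)
    (phi : 'M[R]_(p, q) -> \bar R) : Prop :=
  [/\ 0 < sigma,
      forall x, (-oo < phi x)%E &
      forall (x x' : 'M[R]_(p, q)) (t : R), 0 < t -> t < 1 ->
        (phi ((1 - t) *: x + t *: x')%R <=
           (1 - t)%:E * phi x + t%:E * phi x'
           - (sigma / 2 * t * (1 - t) * enorm (x - x') ^+ 2)%:E)%E].

(* Main.v *)
(* Up to sign, - g is the conjugate of f evaluated at A^T lambda. The conjugate of
   an L-smooth function is strongly convex with constant 1/L: in the supremum
   defining it at a convex combination of a and b, a gradient step of length 1/L
   from any competitor y towards the problem at a, and another towards the
   problem at b, gains by the descent lemma the variance of the two slopes.
   Composition with A^T costs the least eigenvalue of A A^T, the Dirichlet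
   Laplacian of a path, which is bounded below by comparison with its positive
   eigenvector sin(i pi / m). *)
Require Import Defs.
From mathcomp Require Import all_boot all_order all_algebra.
From mathcomp Require Import all_classical all_reals all_analysis.
From mathcomp Require Import ring lra.
Import Order.TTheory GRing.Theory Num.Theory.
Import numFieldNormedType.Exports.
Local Open Scope classical_set_scope.
Local Open Scope ring_scope.
Set Implicit Arguments.
Unset Strict Implicit.

Lemma dotC (R : realType) (p q : nat) (x y : 'M[R]_(p, q)) : dot x y = dot y x.
Proof. by apply: eq_bigr => i _; apply: eq_bigr => j _; rewrite mulrC. Qed.

Lemma dotDl (R : realType) (p q : nat) (x y z : 'M[R]_(p, q)) :
  dot (x + y) z = dot x z + dot y z.
Proof.
rewrite -big_split; apply: eq_bigr => i _; rewrite -big_split.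
by apply: eq_bigr => j _; rewrite mxE mulrDl.
Qed.

Lemma dotZl (R : realType) (p q : nat) (a : R) (x z : 'M[R]_(p, q)) :
  dot (a *: x) z = a * dot x z.
Proof.
rewrite mulr_sumr; apply: eq_bigr => i _; rewrite mulr_sumr.
by apply: eq_bigr => j _; rewrite mxE mulrA.
Qed.

Lemma dotNl (R : realType) (p q : nat) (x z : 'M[R]_(p, q)) :
  dot (- x) z = - dot x z.
Proof. by rewrite -scaleN1r dotZl mulN1r. Qed.

Lemma dotDr (R : realType) (p q : nat) (x y z : 'M[R]_(p, q)) :
  dot z (x + y) = dot z x + dot z y.
Proof. by rewrite !(dotC z) dotDl. Qed.

Lemma dotZr (R : realType) (p q : nat) (a : R) (x z : 'M[R]_(p, q)) :
  dot z (a *: x) = a * dot z x.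
Proof. by rewrite !(dotC z) dotZl. Qed.

Lemma dotNr (R : realType) (p q : nat) (x z : 'M[R]_(p, q)) :
  dot z (- x) = - dot z x.
Proof. by rewrite !(dotC z) dotNl. Qed.

Definition dotE := (dotDl, dotDr, dotNl, dotNr, dotZl, dotZr).

Lemma dot_ge0 (R : realType) (p q : nat) (x : 'M[R]_(p, q)) : 0 <= dot x x.
Proof. by do 2!apply: sumr_ge0 => ? _; rewrite -expr2 sqr_ge0. Qed.

Lemma enorm_sqr (R : realType) (p q : nat) (x : 'M[R]_(p, q)) :
  enorm x ^+ 2 = dot x x.
Proof. by rewrite sqr_sqrtr// dot_ge0. Qed.

Lemma enorm_ge0 (R : realType) (p q : nat) (x : 'M[R]_(p, q)) : 0 <= enorm x.
Proof. exact: sqrtr_ge0. Qed.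

Lemma dot_rowE (R : realType) (p q : nat) (x y : 'M[R]_(p, q)) :
  dot x y = \sum_(i < p) dot (row i x) (row i y).
Proof.
apply: eq_bigr => i _; rewrite /dot big_ord1.
by apply: eq_bigr => j _; rewrite !mxE.
Qed.

Lemma dot_le_of_enorm_le (R : realType) (p q : nat) (K : R) (u d : 'M[R]_(p, q)) :
  0 < K -> enorm u <= K * enorm d -> dot u d <= K * dot d d.
Proof.
move=> K0 ud; have : dot u u <= K ^+ 2 * dot d d.
  by rewrite -!enorm_sqr -exprMn lerXn2r ?nnegrE ?mulr_ge0 ?enorm_ge0// ltW.
have := dot_ge0 (u - K *: d); rewrite !dotE (dotC d u) => h1 h2.
rewrite -(ler_pM2l K0); nra.
Qed.

Lemma derive_dot_grad (R : realType) (n : nat) (f : 'rV[R]_n -> R)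
    (x d : 'rV[R]_n) :
  differentiable f x -> 'D_d f x = dot (grad f x) d.
Proof.
move=> df; rewrite deriveE// [in LHS](row_sum_delta d) linear_sum.
rewrite /dot big_ord1; apply: eq_bigr => j _.
by rewrite linearZ /= mxE deriveE// mulrC.
Qed.

Lemma is_derive_line (R : realType) (n : nat) (f : 'rV[R]_n -> R)
    (x d : 'rV[R]_n) (t : R) :
  differentiable f (x + t *: d) ->
  is_derive t 1 (fun s : R => f (x + s *: d)) (dot (grad f (x + t *: d)) d).
Proof.
move=> df; rewrite -derive_dot_grad//; have Df := @diff_derivable _ _ _ f _ d df.
have E : (fun h : R => h^-1 *: (((fun s : R => f (x + s *: d)) \o shift t) (h *: 1)
    - f (x + t *: d)))
  = (fun h : R => h^-1 *: ((f \o shift (x + t *: d)) (h *: d) - f (x + t *: d))).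
  apply/funext => h /=; congr (_ *: (f _ - _)).
  by rewrite /shift/= scalerDl [h *: 1]mulr1 addrCA.
by split; rewrite /derivable /derive E.
Qed.

Lemma descent (R : realType) (n : nat) (f : 'rV[R]_n -> R) (K : R)
    (x d : 'rV[R]_n) :
  (forall z, differentiable f z) -> 0 < K -> elipschitz K (grad f) ->
  f (x + d) <= f x + dot (grad f x) d + K / 2 * dot d d.
Proof.
move=> df K0 Lf.
pose phi (s : R) := f (x + s *: d) - (dot (grad f x) d * s + K / 2 * dot d d * s ^+ 2).
pose dphi (s : R) := dot (grad f (x + s *: d)) d
  - (dot (grad f x) d + K * dot d d * s).
have Dphi (s : R) : is_derive s 1 phi (dphi s).
  have D1 := is_derive_line (df (x + s *: d)).
  apply: is_derive_eq.
  rewrite /dphi; congr (_ - _); rewrite /GRing.scale/=; lra.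
have Cphi : {within `[0, 1], continuous phi}.
  by apply: derivable_within_continuous => s _; have [] := Dphi s.
have [s + e] := MVT ltr01 (fun s _ => Dphi s) Cphi.
rewrite in_itv/= => /andP[s0 s1].
rewrite /phi scale1r scale0r addr0 in e.
suff : dphi s <= 0 by lra.
have := @dot_le_of_enorm_le _ _ _ (K * s) (grad f (x + s *: d) - grad f x) d.
rewrite mulr_gt0// => /(_ isT); rewrite /dphi !dotE => H.
suff /H : enorm (grad f (x + s *: d) - grad f x) <= K * s * enorm d by lra.
apply: le_trans (Lf _ _) _; rewrite -mulrA ler_pM2l// addrAC subrr add0r.
by rewrite /enorm !dotE mulrA -expr2 sqrtrM ?sqr_ge0// sqrtr_sqr gtr0_norm.
Qed.

(* One gradient step of length 1/K from y against each of the two linear tilts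
   a and b; the gain is the variance of a + G y and b + G y. *)
Lemma tilted_descent (R : realType) (p q : nat) (F : 'M[R]_(p, q) -> R)
    (G : 'M[R]_(p, q) -> 'M[R]_(p, q)) (K t : R) (a b y : 'M[R]_(p, q)) :
  0 < K -> 0 <= t -> t <= 1 ->
  (forall y d, F (y + d) <= F y + dot (G y) d + K / 2 * dot d d) ->
  exists y1 y2,
    (1 - t) * (F y1 + dot a y1) + t * (F y2 + dot b y2) <=
    F y + dot ((1 - t) *: a + t *: b) y
      - 1 / K / 2 * t * (1 - t) * dot (a - b) (a - b).
Proof.
move=> K0 t0 t1 FG.
have step c : F (y + - K^-1 *: (c + G y)) + dot c (y + - K^-1 *: (c + G y)) <=
    F y + dot c y - K^-1 / 2 * dot (c + G y) (c + G y).
  have := FG y (- K^-1 *: (c + G y)); rewrite !dotE (dotC (G y) c).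
  set cc := dot c c; set cg := dot c _; set gg := dot _ (G y).
  have -> : K / 2 * (- K^-1 * (- K^-1 * (cc + cg) + - K^-1 * (cg + gg))) =
    K^-1 / 2 * (cc + cg + (cg + gg)) by field; rewrite gt_eqF.
  lra.
exists (y + - K^-1 *: (a + G y)), (y + - K^-1 *: (b + G y)).
apply: (@le_trans _ _ ((1 - t) * (F y + dot a y - K^-1 / 2 * dot (a + G y) (a + G y))
   + t * (F y + dot b y - K^-1 / 2 * dot (b + G y) (b + G y)))).
  by apply: lerD; apply: ler_wpM2l => //; lra.
have := dot_ge0 ((1 - t) *: (a + G y) + t *: (b + G y)).
have Ki : 0 <= K^-1 / 2 by rewrite divr_ge0// invr_ge0 ltW.
rewrite div1r => /(mulr_ge0 Ki); rewrite !dotE (dotC b a) (dotC (G y) a) (dotC (G y) b).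
lra.
Qed.

(* Riccati form of the discrete Wirtinger inequality: the weight of the boundary
   term u k.+1 ^+ 2 is what makes the induction on k close. *)
Lemma wirtinger_step (R : realFieldType) (c : R) (w u : nat -> R) (k : nat) :
  w 0 = 0 -> u 0 = 0 ->
  (forall i, w i.+2 + w i = 2 * c * w i.+1) ->
  (forall i, (i <= k)%N -> 0 < w i.+1) ->
  (2 - 2 * c) * \sum_(i < k) u i.+1 ^+ 2 + (1 - w k / w k.+1) * u k.+1 ^+ 2 <=
  \sum_(i < k.+1) (u i.+1 - u i) ^+ 2.
Proof.
move=> w0 u0 wrec; elim: k => [|k IH] wpos.
  by rewrite big_ord0 big_ord1 w0 u0 mul0r mulr0 add0r !subr0 mul1r.
rewrite big_ord_recr [leRHS]big_ord_recr/=.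
have {IH} := IH (fun i ik => wpos i (leqW ik)).
have p := wpos k (leqnSn k); have p' := wpos k.+1 (leqnn _).
set S := \sum_(i < k) _; set T := \sum_(i < k.+1) _ => IH.
rewrite mulrDr; set v := u k.+1 in IH *; set v' := u k.+2.
have wE : w k / w k.+1 = 2 * c - w k.+2 / w k.+1.
  have -> : w k = 2 * c * w k.+1 - w k.+2 by rewrite -wrec; ring.
  by field; rewrite gt_eqF.
have : 0 <= (w k.+2 * v - w k.+1 * v') ^+ 2 / (w k.+1 * w k.+2).
  by rewrite divr_ge0 ?sqr_ge0// ltW// mulr_gt0.
have -> : (w k.+2 * v - w k.+1 * v') ^+ 2 / (w k.+1 * w k.+2) =
  w k.+2 / w k.+1 * v ^+ 2 - 2 * v * v' + w k.+1 / w k.+2 * v' ^+ 2.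
  by field; rewrite !gt_eqF.
rewrite wE in IH; lra.
Qed.

Lemma wirtinger (R : realType) (m : nat) (u : nat -> R) :
  u 0 = 0 -> u m.+2 = 0 ->
  (2 - 2 * cos (pi / m.+2%:R)) * \sum_(i < m.+1) u i.+1 ^+ 2 <=
  \sum_(i < m.+2) (u i.+1 - u i) ^+ 2.
Proof.
move=> u0 um; set th := pi / _.
pose w (i : nat) := sin (i%:R * th).
have w0 : w 0 = 0 by rewrite /w mul0r sin0.
have wm : w m.+2 = 0 by rewrite /w /th mulrCA divff ?mulr1 ?sinpi.
have wrec i : w i.+2 + w i = 2 * cos th * w i.+1.
  have -> : w i.+2 = sin (i.+1%:R * th + th) by congr sin; rewrite -[i.+2%:R]natr1; ring.
  have -> : w i = sin (i.+1%:R * th - th) by congr sin; rewrite -[i.+1%:R]natr1; ring.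
  by rewrite sinD sinB /w; ring.
have wpos i : (i <= m)%N -> 0 < w i.+1.
  move=> im; apply: sin_gt0_pi; rewrite /th mulr_gt0 ?divr_gt0 ?pi_gt0//=.
  rewrite mulrCA gtr_pMr ?pi_gt0// ltr_pdivrMr// mul1r ltr_nat.
  by rewrite !ltnS.
have := wirtinger_step w0 u0 wrec wpos.
rewrite [in X in _ -> X <= _]big_ord_recr [in X in _ -> _ <= X]big_ord_recr/= um sub0r sqrrN.
have p := wpos m (leqnn m).
have -> : w m / w m.+1 = 2 * cos th.
  by have := wrec m; rewrite wm add0r => ->; field; rewrite gt_eqF.
lra.
Qed.

(* Rows of l are numbered from 1 here, as in the paper, so that the zero
   boundary rows of A^T l get the indices 0 and m + 1. *)
Definition pad (R : realType) (m n : nat) (l : 'M[R]_(m, n)) (j : 'I_n) (k : nat) : R :=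
  if k is k'.+1 then oapp (fun i : 'I_m => l i j) 0 (insub k') else 0.

Definition adj (R : realType) (m n : nat) (l : 'M[R]_(m, n)) : 'M[R]_(m.+1, n) :=
  \matrix_(i, j) (pad l j i.+1 - pad l j i).

Lemma padS (R : realType) (m n : nat) (l : 'M[R]_(m, n)) (j : 'I_n) (i : 'I_m) :
  pad l j i.+1 = l i j.
Proof. by rewrite /= valK. Qed.

Lemma pad_last (R : realType) (m n : nat) (l : 'M[R]_(m, n)) (j : 'I_n) :
  pad l j m.+1 = 0.
Proof. by rewrite /= insubF// ltnn. Qed.

Lemma adj_comb (R : realType) (m n : nat) (s t : R) (l l' : 'M[R]_(m, n)) :
  adj (s *: l + t *: l') = s *: adj l + t *: adj l'.
Proof.
have padE j k : pad (s *: l + t *: l') j k = s * pad l j k + t * pad l' j k.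
  case: k => [|k] /=; first by rewrite !mulr0 addr0.
  by case: insub => [i|] /=; rewrite ?mxE ?mulr0 ?addr0.
by apply/matrixP => i j; rewrite !mxE !padE; ring.
Qed.

Lemma adjB (R : realType) (m n : nat) (l l' : 'M[R]_(m, n)) :
  adj (l - l') = adj l - adj l'.
Proof.
by have := adj_comb 1 (- 1) l l'; rewrite !scaleN1r !scale1r.
Qed.

Lemma dot_Adiff (R : realType) (m n : nat) (l : 'M[R]_(m, n)) (y : 'M[R]_(m.+1, n)) :
  dot (l : 'M[R]_(m.+1.-1, n)) (Adiff y) = dot (adj l) y.
Proof.
rewrite /dot exchange_big [RHS]exchange_big; apply: eq_bigr => j _ /=.
transitivity (\sum_(i < m) pad l j i.+1 * y (widen_ord (leqnSn m) i) j
            - \sum_(i < m) pad l j i.+1 * y (lift ord0 i) j).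
  rewrite -sumrB; apply: eq_bigr => i _; rewrite padS !mxE mulrBr.
  by congr (_ * y _ _ - _ * y _ _); apply/val_inj.
transitivity (\sum_(i < m.+1) pad l j i.+1 * y i j - \sum_(i < m.+1) pad l j i * y i j).
  by rewrite big_ord_recr [X in _ = _ - X]big_ord_recl pad_last !mul0r /= addr0 add0r.
by rewrite -sumrB; apply: eq_bigr => i _; rewrite !mxE mulrBl.
Qed.

Lemma dot_adj_ge (R : realType) (m n : nat) (l : 'M[R]_(m.+1, n)) :
  (2 - 2 * cos (pi / m.+2%:R)) * dot l l <= dot (adj l) (adj l).
Proof.
rewrite /dot exchange_big [leRHS]exchange_big mulr_sumr; apply: ler_sum => j _ /=.
have := wirtinger (erefl : pad l j 0 = 0) (pad_last l j).
congr (is_true (_ * _ <= _)); apply: eq_bigr => i _; first by rewrite padS expr2.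
by rewrite !mxE expr2.
Qed.

Lemma cos_pi_div_lt1 (R : realType) (m : nat) : cos (pi / m.+2%:R) < 1 :> R.
Proof.
have s0 : 0 < sin (pi / m.+2%:R) :> R.
  apply: sin_gt0_pi; rewrite divr_gt0 ?pi_gt0//=.
  by rewrite gtr_pMr ?pi_gt0// invf_lt1// ltr1n.
have := cos2Dsin2 (pi / m.+2%:R : R); nra.
Qed.

Theorem proposition2 (R : realType) (m n : nat) (hm : (2 <= m)%N)
    (hn : (1 <= n)%N) (f : 'I_m -> 'rV[R]_n -> R) (L : 'I_m -> R)
    (hconv : forall i, strictly_convex (f i))
    (hclosed : forall i, closed_function (f i))
    (hdiff : forall i x, differentiable (f i) x)
    (hLpos : forall i, 0 < L i)
    (hLip : forall i, elipschitz (L i) (grad (f i))) :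
  strongly_convex
    (1 / (\big[Num.max/0]_(i < m) L i) * (2 - 2 * cos (pi / m%:R)))
    (fun lambda => (- dual [set: 'rV[R]_n] f lambda)%E).
Proof.
case: m hm f L hconv hclosed hdiff hLpos hLip => [|[|m]]// _ f L _ _ hdiff hLpos hLip.
set K := \big[Num.max/0]_(i < m.+2) L i.
have LK i : L i <= K by exact: le_bigmax.
have K0 : 0 < K by apply: lt_le_trans (hLpos ord0) (LK _).
pose F (y : 'M[R]_(m.+2, n)) := \sum_i f i (row i y).
pose G (y : 'M[R]_(m.+2, n)) := \matrix_i grad (f i) (row i y).
have FG y d : F (y + d) <= F y + dot (G y) d + K / 2 * dot d d.
  rewrite !dot_rowE mulr_sumr -!big_split; apply: ler_sum => i _ /=.
  rewrite linearD rowK; apply: le_trans (descent _ _ (hdiff i) (hLpos i) (hLip i)) _.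
  by rewrite lerD2l ler_wpM2r ?dot_ge0// ler_pM2r.
have dual_le (l : 'M[R]_(m.+1, n)) y :
    (dual [set: 'rV[R]_n] f l <= (F y + dot (adj l) y)%:E)%E.
  by apply: ereal_inf_lbound; exists y => //; rewrite (dot_Adiff l y).
split.
- by rewrite mulr_gt0 ?divr_gt0// subr_gt0 gtr_pMr// cos_pi_div_lt1.
- by move=> l; rewrite lteNr; apply: le_lt_trans (dual_le l 0) (ltry _).
- move=> a b t t0 t1; rewrite leeNl; apply: le_ereal_inf_tmp => _ [y _ <-].
  rewrite (dot_Adiff _ y) -/(F y) adj_comb leeNl.
  have [y1 [y2 H]] := tilted_descent (adj a) (adj b) y K0 (ltW t0) (ltW t1) FG.
  have tilt_le l z : ((- (F z + dot (adj l) z))%:E <= - dual [set: 'rV[R]_n] f l)%E.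
    by rewrite EFinN leeN2.
  have t1' : 0 <= 1 - t by rewrite subr_ge0 ltW.
  apply: (@le_trans _ _ ((1 - t)%:E * (- (F y1 + dot (adj a) y1))%:E
      + t%:E * (- (F y2 + dot (adj b) y2))%:E
      - (1 / K * (2 - 2 * cos (pi / m.+2%:R)) / 2 * t * (1 - t)
          * enorm (a - b) ^+ 2)%:E)%E); last first.
    by rewrite leeD2r// leeD// lee_wpmul2l// lee_fin// ltW.
  rewrite -!EFinM -!EFinD lee_fin enorm_sqr.
  have := dot_adj_ge (a - b); rewrite adjB => W.
  have c0 : 0 <= 1 / K / 2 * t * (1 - t) by rewrite !mulr_ge0 ?invr_ge0 // ltW.
  have := ler_wpM2l c0 W; lra.
Qed.
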